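(* Let $R$ be a commutative ring with identity and let $M$ be a unital $R$-module. Let $R(+)M$ denote the idealization of $M$ in $R$. (1) If $R(+)M$ is a BFR, then $R$ is a BFR and $M$ is a BFM. (2) If $R$ is a BFR, $M$ is a BFM, and $0\in R$ is U-bounded, then $R(+)M$ is a BFR.
   Context: All rings are commutative with identity and all modules are unital. The idealization $R(+)M$ of an $R$-module $M$ is the ring with underlying set $R\times M$, componentwise addition, and multiplication $(r_1,x_1)(r_2,x_2)=(r_1r_2,\ r_1x_2+r_2x_1)$. A ring $A$ is a bounded factorization ring (BFR) if for every nonzero nonunit $r\in A$ there exists $n_r\in\mathbb{N}$ such that whenever $r=r_1\cdots r_n$ with all $r_i\in A$ nonunits, then $n\le n_r$. An $R$-module $M$ is a BFM if for every nonzero $x\in M$ there exists $n_x\in\mathbb{N}$ such that whenever $x=r_1\cdots r_n y$ with all $r_i\in R$ nonunits and $y\in M$, then $n\le n_x$. A factorization $x=a_1\cdots a_n$ in $R$ is minimal if no factors can be removed from it, i.e. $x\neq\prod_{i\in J}a_i$ for every proper subset $J\subsetneq\{1,\dots,n\}$. The element $0\in R$ is U-bounded if the set of all $n\in\mathbb{N}$ for which there exist nonunits $a_1,\dots,a_n\in R$ such that $0=a_1\cdots a_n$ is a minimal factorization is bounded. *)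

(* Defs.v *)
From HB Require Import structures.
From mathcomp Require Import all_boot all_order all_algebra.

Set Implicit Arguments.
Unset Strict Implicit.
Unset Printing Implicit Defensive.

Import GRing.Theory.
Local Open Scope ring_scope.

(* Rings are [comPzRingType]s, so the zero ring is allowed; [GRing.unit] is    *)
(* not available there (it needs a boolean unit predicate), hence [nonunit].  *)
Definition nonunit (A : comPzRingType) (a : A) : Prop :=
  ~ exists b : A, a * b = 1.

Definition idealization (R : comPzRingType) (M : lmodType R) : Type :=
  (R * M)%type.

Section IdealizationRing.
Variables (R : comPzRingType) (M : lmodType R).
Local Notation RM := (idealization M).

(* Only the additive structure of the product is inherited: its componentwise *)
(* ring structure, present when M is itself a ring, must not leak in.         *)
HB.instance Definition _ := GRing.Zmodule.copy RM (R * M)%type.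

Definition idealization_one : RM := (1, 0).

Definition idealization_mul (u v : RM) : RM :=
  (u.1 * v.1, u.1 *: v.2 + v.1 *: u.2).

Fact idealization_mulA : associative idealization_mul.
Proof.
move=> [a x] [b y] [c z]; rewrite /idealization_mul /= mulrA.
by rewrite !scalerDr !scalerA addrA [c * a]mulrC [c * b]mulrC [b * c]mulrC.
Qed.

Fact idealization_mulC : commutative idealization_mul.
Proof.
by move=> [a x] [b y]; rewrite /idealization_mul /= mulrC addrC.
Qed.

Fact idealization_mul1 : left_id idealization_one idealization_mul.
Proof.
by move=> [a x]; rewrite /idealization_mul /= mul1r scale1r scaler0 addr0.
Qed.

Fact idealization_mulDl : left_distributive idealization_mul +%R.
Proof.
move=> [a x] [b y] [c z]; rewrite /idealization_mul /=.
by congr pair; rewrite /= ?mulrDl // scalerDl scalerDr addrACA.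
Qed.

HB.instance Definition _ := GRing.Zmodule_isComPzRing.Build RM
  idealization_mulA idealization_mulC idealization_mul1 idealization_mulDl.

End IdealizationRing.

Definition BFR (A : comPzRingType) : Prop :=
  forall r : A, r <> 0 -> nonunit r ->
  exists N : nat, forall (n : nat) (a : 'I_n -> A),
    (forall i, nonunit (a i)) -> r = \prod_(i < n) a i -> (n <= N)%N.

Definition BFM (R : comPzRingType) (M : lmodType R) : Prop :=
  forall x : M, x <> 0 ->
  exists N : nat, forall (n : nat) (a : 'I_n -> R) (y : M),
    (forall i, nonunit (a i)) -> x = (\prod_(i < n) a i) *: y -> (n <= N)%N.

Definition minimal_factorization (A : comPzRingType) (x : A) (n : nat)
    (a : 'I_n -> A) : Prop :=
  x = \prod_(i < n) a i /\
  forall J : {set 'I_n}, J \proper [set: 'I_n] -> x <> \prod_(i in J) a i.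

Definition zero_U_bounded (A : comPzRingType) : Prop :=
  exists N : nat, forall n : nat,
    (exists a : 'I_n -> A,
       (forall i, nonunit (a i)) /\ minimal_factorization 0 a) -> (n <= N)%N.

(* Main.v *)
(** An element (a, x) of R(+)M is a unit iff a is, and r |-> (r, 0) and
    (r, x) |-> r are multiplicative; this gives (1), and it gives (2) for the
    elements (r, x) with r <> 0.  If (0, x) is a product of n nonunits
    (a_i, x_i), choose J minimal with \prod_(i in J) a_i = 0.  Then #|J| is at
    most the U-bound of 0, and the product over J is some (0, y), so that
    x = (\prod_(i notin J) a_i) y bounds n - #|J|. *)
Require Import Defs.
From mathcomp Require Import all_boot all_order all_algebra.

Import GRing.Theory.
Local Open Scope ring_scope.

Lemma idealizationME (R : comPzRingType) (M : lmodType R)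
    (u v : idealization M) :
  u * v = (u.1 * v.1, u.1 *: v.2 + v.1 *: u.2).
Proof. by []. Qed.

Lemma nonunit_idealization (R : comPzRingType) (M : lmodType R)
    (u : idealization M) :
  nonunit u <-> nonunit u.1.
Proof.
split=> uN [b]; last by case=> ab1 _; apply: uN; exists b.1.
(* The second coordinate [z] of the inverse must solve [u.1 *: z + b *: u.2 = 0]; multiplying by [b]
   gives this value. *)
move=> ab1; apply: uN; exists (b, - ((b * b) *: u.2)).
by rewrite idealizationME /= scalerN scalerA mulrA ab1 mul1r addNr.
Qed.

Lemma prod_idealization_fst (R : comPzRingType) (M : lmodType R) (I : finType)
    (P : pred I) (u : I -> idealization M) :
  (\prod_(i | P i) u i).1 = \prod_(i | P i) (u i).1.
Proof. exact: (big_morph (fun v : idealization M => v.1)). Qed.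

Lemma prod_idealization_inl (R : comPzRingType) (M : lmodType R) (I : finType)
    (P : pred I) (a : I -> R) :
  \prod_(i | P i) ((a i, 0) : idealization M) = (\prod_(i | P i) a i, 0).
Proof.
apply/esym/(big_morph (fun r : R => (r, 0) : idealization M)) => // r s.
by rewrite idealizationME /= !scaler0 addr0.
Qed.

Lemma BFR_idealization_ring (R : comPzRingType) (M : lmodType R) :
  BFR (idealization M) -> BFR R.
Proof.
move=> bfrRM r r0 rN.
have [|| N HN] := bfrRM ((r, 0) : idealization M).
- by case.
- exact/nonunit_idealization.
exists N => n a aN rE; apply: (HN n (fun i => (a i, 0))) => [i|].
  exact/nonunit_idealization/aN.
by rewrite prod_idealization_inl -rE.
Qed.

(** In the zero ring [0] is a unit, but a module over that ring is trivial. This makes [(0, y)] an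
    admissible factor below. *)
Lemma nonunit0 (R : comPzRingType) (M : lmodType R) (x : M) :
  x <> 0 -> nonunit (0 : R).
Proof.
move=> x0 [b]; rewrite mul0r => R01; apply: x0.
by rewrite -[x]scale1r -R01 scale0r.
Qed.

Lemma BFR_idealization_module (R : comPzRingType) (M : lmodType R) :
  BFR (idealization M) -> BFM M.
Proof.
move=> bfrRM x x0; have N0 := nonunit0 R M x x0.
have [|| N HN] := bfrRM ((0, x) : idealization M).
- by case.
- exact/nonunit_idealization.
(* The factor [(0, y)] joins the [n] factors [(a i, 0)], so the bound obtained is on [n.+1]. *)
exists N => n a y aN xE; apply/ltnW.
pose u (i : 'I_n.+1) : idealization M :=
  if unlift ord0 i is Some j then (a j, 0) else (0, y).
apply: (HN n.+1 u) => [i|].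
  by apply/nonunit_idealization; rewrite /u; case: unlift => /=.
rewrite big_ord_recl /u unlift_none.
under eq_bigr do rewrite liftK.
by rewrite prod_idealization_inl idealizationME /= mul0r scaler0 add0r xE.
Qed.

Lemma zero_subproduct_bounded (R : comPzRingType) :
  zero_U_bounded R ->
  exists N : nat, forall (n : nat) (a : 'I_n -> R),
    (forall i, nonunit (a i)) -> \prod_(i < n) a i = 0 ->
    exists J : {set 'I_n}, (#|J| <= N)%N /\ \prod_(i in J) a i = 0.
Proof.
move=> [N HN]; exists N => n a aN prod0.
pose P (J : {set 'I_n}) := \prod_(i in J) a i == 0.
have [|J /minsetP [/eqP PJ Jmin] _] := @minset_exists _ P [set: 'I_n].
  by apply/eqP; rewrite -[RHS]prod0; apply: eq_bigl => i; rewrite inE.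
exists J; split=> //; apply: HN.
(* The subfamily over [J] is reindexed by ordinals. If a proper [K] also gave product [0], its image
   in [J] would equal [J] by minimality, against the cardinalities. *)
exists (fun k : 'I_#|J| => a (enum_val k)); split=> [k|]; first exact: aN.
split=> [|K Kproper]; first by rewrite -(big_enum_val a).
have inj_val : injective (@enum_val _ (mem J)) by exact: enum_val_inj.
rewrite -(big_imset a) => [K0|k l _ _]; last exact: inj_val.
have /Jmin KJ : P (enum_val @: K) by apply/eqP.
have /KJ /(congr1 (fun A : {set _} => #|A|)) : enum_val @: K \subset J.
  by apply/subsetP => _ /imsetP [k _ ->]; exact: enum_valP.
rewrite card_imset // => cardK; move: (proper_card Kproper).
by rewrite cardsT card_ord cardK ltnn.
Qed.

(** Enumerating [A] reduces this to families over ordinals; the form over sets is what the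
    complement of [J] calls for. *)
Lemma BFM_card (R : comPzRingType) (M : lmodType R) (x : M) :
  BFM M -> x <> 0 ->
  exists N : nat, forall (I : finType) (A : {set I}) (a : I -> R) (y : M),
    (forall i, nonunit (a i)) -> x = (\prod_(i in A) a i) *: y ->
    (#|A| <= N)%N.
Proof.
move=> bfmM /bfmM [N HN]; exists N => I A a y aN xE.
apply: (HN _ (fun k => a (enum_val k)) y) => [k|]; first exact: aN.
by rewrite -(big_enum_val a).
Qed.

Lemma idealization_BFR (R : comPzRingType) (M : lmodType R) :
  BFR R -> BFM M -> zero_U_bounded R -> BFR (idealization M).
Proof.
move=> bfrR bfmM /zero_subproduct_bounded [N0 HN0] [r x] rx0.
move=> /nonunit_idealization rN.
have [r0|/eqP r0] := eqVneq r 0; last first.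
  have [N HN] := bfrR r r0 rN; exists N => n u uN uE.
  apply: (HN n (fun i => (u i).1)) => [i|]; first exact/nonunit_idealization.
  by rewrite -prod_idealization_fst -uE.
have x0 : x <> 0 by move=> x0; apply: rx0; rewrite r0 x0.
have [N HN] := BFM_card R M x bfmM x0.
(* [N0] bounds [#|J|] and [N] bounds the size of its complement. *)
exists (N0 + N)%N => n u uN uE.
have aN i : nonunit (u i).1 by apply/nonunit_idealization.
have [|J [cardJ J0]] := HN0 n (fun i => (u i).1) aN.
  by rewrite -prod_idealization_fst -uE.
rewrite -[n]card_ord -(cardsC J) leq_add //.
apply: (HN _ _ _ (\prod_(i in J) u i).2 aN).
(* Of the two terms in the second coordinate, the one scaled by the product over [J] vanishes. *)
move: uE; rewrite (bigID (mem J)) /= idealizationME => -[_ ->].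
rewrite !prod_idealization_fst J0 scale0r add0r.
by congr (_ *: _); apply: eq_bigl => i; rewrite inE.
Qed.

Theorem proposition5 (R : comPzRingType) (M : lmodType R) :
  (BFR (idealization M) -> BFR R /\ BFM M) /\
  (BFR R -> BFM M -> zero_U_bounded R -> BFR (idealization M)).
Proof.
split; last exact: idealization_BFR.
move=> bfrRM; split; first exact: BFR_idealization_ring bfrRM.
exact: BFR_idealization_module.
Qed.
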